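(* Let $G=(V,E)$ be a Gaussian tree, and let $a,c,c'\in V$ with $a\ne c$ be such that $c$ lies on the unique path in $G$ joining $a$ and $c'$ (endpoints included). Then for any $Z\subseteq V\setminus\{a,c,c'\}$, $$\rho^2_{ac'\mid Z}\le\rho^2_{ac\mid Z}.$$
   Context: A Gaussian tree is a finite undirected tree $G=(V,E)$ together with a Gaussian random vector indexed by $V$ (also denoted $V$), $V\sim N(\mu,\Sigma)$ with $\Sigma$ positive definite, such that for pairwise disjoint $T_1,T_2,T_3\subseteq V$, $T_1$ and $T_2$ are conditionally independent given $T_3$ whenever $T_3$ separates $T_1$ from $T_2$ in $G$, i.e. every path from a vertex of $T_1$ to a vertex of $T_2$ intersects $T_3$. (The converse is not assumed.) For distinct $u,v$ and $Z\subseteq V\setminus\{u,v\}$ the squared partial correlation is $$\rho^2_{uv\mid Z}=\frac{(\sigma_{uv}-\Sigma_{uZ}\Sigma_{ZZ}^{-1}\Sigma_{Zv})^2}{(\sigma_{uu}-\Sigma_{uZ}\Sigma_{ZZ}^{-1}\Sigma_{Zu})(\sigma_{vv}-\Sigma_{vZ}\Sigma_{ZZ}^{-1}\Sigma_{Zv})},$$ where $\sigma_{uv}$ is the $(u,v)$ entry of $\Sigma$ and $\Sigma_{uZ}$ etc. are submatrices; for $Z=\emptyset$ the correction terms are absent. *)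

(* Defs.v *)
From HB Require Import structures.
From mathcomp Require Import all_boot all_order all_algebra.
From mathcomp Require Import all_classical all_reals all_analysis.

Set Implicit Arguments.
Unset Strict Implicit.
Unset Printing Implicit Defensive.

Import Order.TTheory GRing.Theory Num.Theory.
Import numFieldNormedType.Exports.

Local Open Scope classical_set_scope.
Local Open Scope ring_scope.

(* A simple graph is given by its adjacency relation [e]; [x :: p] is the vertex
   sequence of a simple path from [x] to [y]. *)
Definition gpath (V : finType) (e : rel V) (x y : V) (p : seq V) : bool :=
  [&& path e x p, uniq (x :: p) & last x p == y].

(* The bound 3 excludes the degenerate cycle [:: x; y] along a single edge. *)
Definition acyclic (V : finType) (e : rel V) : Prop :=
  forall s : seq V, cycle e s -> uniq s -> (size s < 3)%N.

Definition is_tree (V : finType) (e : rel V) : Prop :=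
  [/\ symmetric e, irreflexive e, (forall x y, connect e x y) & acyclic e].

Definition separates (V : finType) (e : rel V) (T3 T1 T2 : {set V}) : Prop :=
  forall (x y : V) (p : seq V), x \in T1 -> y \in T2 -> gpath e x y p ->
    exists2 z, z \in x :: p & z \in T3.

Definition block (R : realType) (V : finType) (S : V -> V -> R)
    (A B : {set V}) : 'M[R]_(#|A|, #|B|) :=
  \matrix_(i < #|A|, j < #|B|) S (enum_val i) (enum_val j).

Definition block_row (R : realType) (V : finType) (S : V -> V -> R)
    (u : V) (B : {set V}) : 'rV[R]_#|B| :=
  \row_(j < #|B|) S u (enum_val j).

Definition block_col (R : realType) (V : finType) (S : V -> V -> R)
    (A : {set V}) (v : V) : 'cV[R]_#|A| :=
  \col_(i < #|A|) S (enum_val i) v.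

Definition posdef (R : realType) (V : finType) (S : V -> V -> R) : Prop :=
  (forall u v, S u v = S v u) /\
  (forall x : V -> R, (exists v, x v != 0) ->
     0 < \sum_(u : V) \sum_(v : V) x u * S u v * x v).

(* For [Z = set0] the correction term is a product of matrices with an empty
   inner dimension, hence 0. *)
Definition pcov (R : realType) (V : finType) (S : V -> V -> R)
    (Z : {set V}) (u v : V) : R :=
  S u v - (block_row S u Z *m invmx (block S Z Z) *m block_col S Z v) 0 0.

Definition sq_pcorr (R : realType) (V : finType) (S : V -> V -> R)
    (Z : {set V}) (u v : V) : R :=
  pcov S Z u v ^+ 2 / (pcov S Z u u * pcov S Z v v).

(* The sigma-algebra generated by the [X v], [v \in A]; trivial if [A] is empty. *)
Definition sigma_of (T : Type) (R : realType) (V : finType)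
    (X : V -> T -> R) (A : {set V}) : set (set T) :=
  <<s \bigcup_(v in [set` A]) preimage_set_system setT (X v) measurable >>.

Definition borel_family (R : realType) (V : finType) : set (set (V -> R)) :=
  sigma_of (fun v x => x v) [set: V]%SET.

(* Integration of the coordinates listed in [s], the others being those of [x]. *)
Fixpoint iter_integral (R : realType) (V : finType) (s : seq V)
    (f : (V -> R) -> \bar R) (x : V -> R) : \bar R :=
  if s is v :: s' then
    \int[lebesgue_measure]_t
       iter_integral s' f (fun u => if u == v then t else x u)
  else f x.

(* The integral of [f] for Lebesgue measure on R^V, as an iterated integral; it
   is used only for nonnegative Borel [f], for which Tonelli's theorem makes
   the order of integration immaterial. *)
Definition family_integral (R : realType) (V : finType)
    (f : (V -> R) -> \bar R) : \bar R :=
  iter_integral (enum V) f (fun=> 0).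

Definition gauss_pdf (R : realType) (V : finType) (mu : V -> R)
    (S : V -> V -> R) (x : V -> R) : R :=
  let M := block S [set: V]%SET [set: V]%SET in
  let d : 'cV[R]_#|[set: V]%SET| :=
    \col_i (x (enum_val i) - mu (enum_val i)) in
  (Num.sqrt ((2 * pi) ^+ #|V| * \det M))^-1
  * expR (- 2^-1 * (d^T *m invmx M *m d) 0 0).

(* [X ~ N(mu, S)]; meaningful for positive definite [S] only. *)
Definition gaussian_vector (d : measure_display) (T : measurableType d)
    (R : realType) (P : probability T R) (V : finType)
    (X : V -> {RV P >-> R}) (mu : V -> R) (S : V -> V -> R) : Prop :=
  forall B : set (V -> R), @borel_family R V B ->
    P [set w | B (fun v => X v w)] =
    family_integral (fun x => (\1_B x * gauss_pdf mu S x)%:E).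

(* [g] is a version of the conditional probability P(A | G). *)
Definition cond_prob (d : measure_display) (T : measurableType d)
    (R : realType) (P : probability T R) (G : set (set T)) (A : set T)
    (g : T -> R) : Prop :=
  [/\ preimage_set_system setT g measurable `<=` G,
      P.-integrable setT (EFin \o g) &
      forall C, G C -> (\int[P]_(w in C) (g w)%:E)%E = P (A `&` C)].

(* P(A1 /\ A2 | G) = P(A1 | G) P(A2 | G) almost surely.  As versions exist and
   are almost surely unique, it does not matter which ones are chosen. *)
Definition cond_indep (d : measure_display) (T : measurableType d)
    (R : realType) (P : probability T R) (F1 F2 G : set (set T)) : Prop :=
  forall A1 A2, F1 A1 -> F2 A2 ->
    exists g1 g2 g12 : T -> R,
      [/\ cond_prob P G A1 g1, cond_prob P G A2 g2,
          cond_prob P G (A1 `&` A2) g12 &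
          {ae P, forall w, g12 w = g1 w * g2 w}].

Definition global_markov (d : measure_display) (T : measurableType d)
    (R : realType) (P : probability T R) (V : finType) (e : rel V)
    (X : V -> {RV P >-> R}) : Prop :=
  forall T1 T2 T3 : {set V},
    [disjoint T1 & T2]%B -> [disjoint T1 & T3]%B -> [disjoint T2 & T3]%B ->
    separates e T3 T1 T2 ->
    cond_indep P (sigma_of X T1) (sigma_of X T2) (sigma_of X T3).

Definition gaussian_tree (d : measure_display) (T : measurableType d)
    (R : realType) (P : probability T R) (V : finType) (e : rel V)
    (X : V -> {RV P >-> R}) (mu : V -> R) (S : V -> V -> R) : Prop :=
  [/\ is_tree e, posdef S, gaussian_vector X mu S & global_markov e X].

(* Main.v *)
(* Let [K] be the inverse of [Sigma].  For non-adjacent [u], [v] the Markov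
   property makes [X u] and [X v] independent given all the other coordinates,
   and this forces [K u v = 0]: moving a box by [t] in the coordinate [u]
   multiplies the Gaussian density by a factor in which [x v] occurs as
   [expR (- t * K u v * x v)], so if [K u v] were nonzero, the odds between two
   intervals for [X u] would differ between two far apart intervals for [X v],
   uniformly for the other coordinates in the unit cube.  Only translation
   invariance of the iterated integral is used, so no marginal or conditional
   density has to be computed.

   Since [c] cuts [a] off from [c'], the sparsity of [K] then gives
   [pcov Z a c' = pcov Z a c / pcov Z c c * pcov Z c c'], hence the squared
   correlation of [a] and [c'] is the product of those of [a, c] and [c, c'],
   and the latter is at most 1. *)

Require Import Defs.
From mathcomp Require Import all_boot all_order all_algebra.
From mathcomp Require Import all_classical all_reals all_analysis.
From mathcomp Require Import measurable_realfun ring lra.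

Set Implicit Arguments.
Unset Strict Implicit.
Unset Printing Implicit Defensive.

Import Order.TTheory GRing.Theory Num.Theory.
Import numFieldNormedType.Exports HBNNSimple.

Local Open Scope ring_scope.

(** * Graphs and partial covariances *)

(** Without an edge between [u] and [v], the second vertex of a simple path joining them differs
    from both ends. *)
Lemma pairwise_separates (V : finType) (e : rel V) (u v : V) :
  u != v -> ~~ e u v ->
  [/\ [disjoint [set u]%SET & [set v]%SET]%B,
      [disjoint [set u]%SET & ~: [set u; v]%SET]%B,
      [disjoint [set v]%SET & ~: [set u; v]%SET]%B &
      separates e (~: [set u; v])%SET [set u]%SET [set v]%SET].
Proof.
move=> uv nuv; split.
- by rewrite disjoints1 finset.in_set1.
- by rewrite disjoints1 !finset.inE eqxx.
- by rewrite disjoints1 !finset.inE eqxx orbT.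
move=> x y p /finset.set1P -> /finset.set1P -> /and3P[pth /andP[nup]].
case: p pth nup => [|z [|t p]] /=; first by rewrite (negPf uv).
  by rewrite andbT => euz _ _ /eqP zv; rewrite -zv euz in nuv.
rewrite !inE !negb_or => _ /and3P[uz _ _] /andP[/andP[zt zp] _] /eqP lst.
exists z; first by rewrite !inE eqxx orbT.
rewrite !finset.inE negb_or [z == u]eq_sym uz /=; apply/eqP => zv.
by have := mem_last t p; rewrite lst -zv inE (negPf zt) (negPf zp).
Qed.

(** A walk from [a] to [c'] that never enters [c] would join the two neighbours of [c] on the path
    without using [c]; closing it up through [c] gives a cycle. *)
Lemma acyclic_cut_vertex (V : finType) (e : rel V) (a c c' : V) (p : seq V) :
  symmetric e -> acyclic e -> gpath e a c' p -> c \in p -> c != c' ->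
  ~~ connect [rel x y | e x y && (y != c)] a c'.
Proof.
move=> sym_e acyc /and3P[pth unq /eqP lst] cp cc'; apply/negP => con.
case/splitPr: cp unq pth lst => p1 p2.
rewrite -cat_cons cat_uniq => /and3P[un1 /hasPn nh unq2].
rewrite cat_path /= last_cat /= => /and3P[pth1 ec pth2].
case: p2 pth2 nh unq2 => [|y p2] /=; first by move=> _ _ _ E; rewrite E eqxx in cc'.
move=> /andP[cy pth2] nh /and3P[cy2 _ _] lst.
set g := [rel x y | e x y && (y != c)] in con.
have sub (x : V) s : path e x s -> c \notin s -> path g x s.
  elim: s x => //= z s IH x /andP[exz pz]; rewrite inE negb_or => /andP[cz cs].
  by rewrite exz eq_sym cz IH.
have cn1 : c \notin a :: p1 by apply: nh; rewrite inE eqxx.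
have la : last a p1 != c by apply: contraNneq cn1 => <-; exact: mem_last.
have ca : a != c by apply: contraNneq cn1 => ->; rewrite inE eqxx.
(* [g] is symmetric away from [c] *)
have symg (x z : V) : x != c -> connect g x z -> connect g z x.
  move=> xc /connectP[s ps ->]; elim: s x xc ps => //= t s IH x xc /andP[/andP[ext tc] ps].
  by apply: connect_trans (IH _ tc ps) (connect1 _); rewrite /= sym_e ext xc.
have con1 : connect g (last a p1) a.
  apply: symg => //; apply/connectP; exists p1 => //; apply: sub => //.
  by apply: contraNN cn1 => h; rewrite inE h orbT.
have con2 : connect g c' y.
  apply: symg; first by apply: contraNneq cy2 => <-; rewrite inE eqxx.
  apply/connectP; exists p2 => //; apply: sub => //.
  by apply: contraNN cy2 => h; rewrite inE h orbT.
(* Back along [p1] to [a], along the assumed walk to [c'], then back along [p2] to [y]. *)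
have /connectP[s ps ly] := connect_trans con1 (connect_trans con con2).
move: ly; case/shortenP: ps => s' ps' us' _ ly.
have pe : path e (last a p1) s' by apply: sub_path ps' => ? ? /andP[].
have cs' : c \notin s'.
  apply/negP => cs; case/splitPr: cs ps' => q1 q2.
  by rewrite cat_path /= eqxx !andbF.
have cyc : cycle e (c :: last a p1 :: s').
  by rewrite /= rcons_path sym_e ec pe -ly sym_e cy.
have := acyc _ cyc; rewrite cons_uniq us' andbT inE negb_or eq_sym la cs' => /(_ isT).
(* The size bound leaves only an empty [s'], where both neighbours of [c] coincide, against the
   uniqueness of the vertices of the path. *)
case: s' ly {pe cyc us' cs' ps'} => //= ly.
have := nh y; rewrite !inE eqxx orbT => /(_ isT).
by rewrite ly; have := mem_last a p1; rewrite inE => ->.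
Qed.

Section PartialCovariance.
Variables (R : realType) (V : finType) (S : V -> V -> R).
Hypothesis Spd : posdef S.

Let Ssym u v : S u v = S v u. Proof. by case: Spd. Qed.

(** The quadratic form at [x] is a sum in which each term contains [x v] times the [v]-th entry of
    [x S], and one of the two vanishes. *)
Lemma posdef_eq0 (x : V -> R) :
  (forall u, x u != 0 -> \sum_v x v * S v u = 0) -> forall u, x u = 0.
Proof.
move=> h u; apply/eqP/negP => /negP xu.
have := Spd.2 x (ex_intro _ u xu).
rewrite exchange_big big1 ?ltxx // => v _; rewrite -mulr_suml.
by have [->|/h ->] := eqVneq (x v) 0; rewrite ?mulr0 ?mul0r.
Qed.

Lemma posdef_ge0 (x : V -> R) : 0 <= \sum_u \sum_v x u * S u v * x v.
Proof.
have [/existsP ex|] := boolP [exists v, x v != 0]; first exact/ltW/Spd.2.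
move=> /existsPn nx; rewrite big1 // => u _; rewrite big1 // => v _.
by have := nx v; rewrite negbK => /eqP ->; rewrite mulr0.
Qed.

(** A vector in the left kernel of the block, extended by zero outside [Z], falls under
    [posdef_eq0]. *)
Lemma block_unit (Z : {set V}) : block S Z Z \in unitmx.
Proof.
rewrite -row_free_unit; apply/inj_row_free => y hy.
pose x v := if insub v is Some i then y 0 (enum_rank_in (valP (i : {v | v \in Z})) v) else 0.
have xE i : x (enum_val i) = y 0 i.
  rewrite /x; case: insubP => [j _ jE|]; last by rewrite enum_valP.
  congr (y 0 _); rewrite -[in RHS](enum_valK_in (valP j) i) //.
have x0 v : v \notin Z -> x v = 0.
  by move=> vZ; rewrite /x; case: insubP => // j; rewrite (negPf vZ).
have sumx F : \sum_v x v * F v = \sum_i y 0 i * F (enum_val i).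
  rewrite (bigID (mem Z)) /= [X in _ + X]big1 ?addr0; last first.
    by move=> v /x0 ->; rewrite mul0r.
  by rewrite [LHS]big_enum_val /=; apply: eq_bigr => i _; rewrite xE.
have xz : forall u, x u = 0.
  apply: posdef_eq0 => u xu.
  have uZ : u \in Z by apply: contraNT xu => /x0 ->.
  rewrite sumx; have := congr1 (fun m : 'rV_ _ => m 0 (enum_rank_in uZ u)) hy.
  rewrite !mxE => sum0; rewrite -[RHS]sum0; apply: eq_bigr => i _.
  by rewrite mxE enum_rankK_in.
by apply/rowP => i; rewrite -xE xz mxE.
Qed.

(* Coefficients of the residual of [u] in the regression on [Z]. *)
Lemma residual_coefs (Z : {set V}) (u : V) : exists x : V -> R,
  [/\ forall w, pcov S Z u w = \sum_v x v * S v w,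
      forall w, w \in Z -> pcov S Z u w = 0 &
      forall w, w \notin Z -> x w = (w == u)%:R].
Proof.
pose b := block_row S u Z *m invmx (block S Z Z).
pose x v := (v == u)%:R - (if insub v is Some i then b 0 (enum_rank_in (valP (i : {v | v \in Z})) v) else 0).
exists x; split => [w|w wZ|w wZ].
- rewrite /x; under eq_bigr do rewrite mulrBl; rewrite sumrB /pcov -/b; congr (_ - _).
    rewrite (bigD1 u) //= eqxx mul1r big1 ?addr0 // => v /negPf ->.
    by rewrite mul0r.
  rewrite mxE [RHS](bigID (mem Z)) /= [X in _ = _ + X]big1 ?addr0; last first.
    by move=> v vZ; case: insubP => [j|]; rewrite ?(negPf vZ) // mul0r.
  rewrite [RHS]big_enum_val /=; apply: eq_bigr => i _; rewrite [block_col _ _ _ _ _]mxE; congr (_ * _).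
  case: insubP => [j _ jE|]; last by rewrite enum_valP.
  by congr (b 0 _); rewrite -[in LHS](enum_valK_in (valP j) i).
(* For [w] in [Z] the vector [block_col S Z w] is a column of [block S Z Z], so the inverse
   cancels. *)
- rewrite /pcov; set j := enum_rank_in wZ w.
  have -> : (block_row S u Z *m invmx (block S Z Z) *m block_col S Z w) 0 0
      = (block_row S u Z *m invmx (block S Z Z) *m block S Z Z) 0 j.
    rewrite [LHS]mxE [RHS]mxE; apply: eq_bigr => i _; congr (_ * _).
    by rewrite !mxE enum_rankK_in.
  by rewrite mulmxKV ?block_unit // mxE enum_rankK_in // subrr.
- by rewrite /x; case: insubP => [j|]; rewrite ?(negPf wZ) // subr0.
Qed.

(** The residual of [u] is uncorrelated with [Z], so only the entries of [y] outside [Z] count. With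
    [y] the residual coefficients of [w], this makes [pcov] a value of the bilinear form of [S]. *)
Lemma pcov_formE (Z : {set V}) (u w : V) (x y : V -> R) :
  (forall w, pcov S Z u w = \sum_v x v * S v w) ->
  (forall w, w \in Z -> pcov S Z u w = 0) ->
  (forall v, v \notin Z -> y v = (v == w)%:R) -> w \notin Z ->
  \sum_s \sum_t x s * S s t * y t = pcov S Z u w.
Proof.
move=> xE x0 yE wZ; rewrite exchange_big /=.
under eq_bigr do rewrite -mulr_suml -xE.
rewrite (bigD1 w) //= yE // eqxx mulr1 big1 ?addr0 // => v vw.
by have [/x0 ->|/yE ->] := boolP (v \in Z); rewrite ?(negPf vw) ?mulr0 ?mul0r.
Qed.

Lemma pcov_gt0 (Z : {set V}) (u : V) : u \notin Z -> 0 < pcov S Z u u.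
Proof.
move=> uZ; have [x [xE x0 xd]] := residual_coefs Z u.
rewrite -(pcov_formE xE x0 xd) //; apply: Spd.2; exists u.
by rewrite xd // eqxx oner_eq0.
Qed.

Lemma pcov_sym (Z : {set V}) (u w : V) : u \notin Z -> w \notin Z ->
  pcov S Z u w = pcov S Z w u.
Proof.
move=> uZ wZ; have [x [xE x0 xd]] := residual_coefs Z u.
have [y [yE y0 yd]] := residual_coefs Z w.
rewrite -(pcov_formE xE x0 yd) // -(pcov_formE yE y0 xd) // exchange_big /=.
by apply: eq_bigr => s _; apply: eq_bigr => t _; rewrite Ssym; ring.
Qed.

Lemma pcov_cauchy_schwarz (Z : {set V}) (u w : V) : u \notin Z -> w \notin Z ->
  pcov S Z u w ^+ 2 <= pcov S Z u u * pcov S Z w w.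
Proof.
move=> uZ wZ; have [x [xE x0 xd]] := residual_coefs Z u.
have [y [yE y0 yd]] := residual_coefs Z w.
(* Up to the factor [- m], the vector [l * x - m * y] is the part of [y] orthogonal to [x]; the
   factor avoids a division. *)
pose l := pcov S Z u w; pose m := pcov S Z u u.
have := posdef_ge0 (fun v => l * x v - m * y v).
have -> : \sum_s \sum_t (l * x s - m * y s) * S s t * (l * x t - m * y t) =
   l * l * (\sum_s \sum_t x s * S s t * x t) - l * m * (\sum_s \sum_t x s * S s t * y t)
   - l * m * (\sum_s \sum_t y s * S s t * x t) + m * m * (\sum_s \sum_t y s * S s t * y t).
  rewrite !mulr_sumr -!sumrB -big_split; apply: eq_bigr => s _.
  rewrite /= !mulr_sumr -!sumrB -big_split; apply: eq_bigr => t _ /=; ring.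
rewrite (pcov_formE xE x0 xd) // (pcov_formE xE x0 yd) //.
rewrite (pcov_formE yE y0 xd) // (pcov_formE yE y0 yd) // -(pcov_sym uZ wZ) -/l -/m.
have m0 : 0 < m by exact: pcov_gt0.
have -> : l * l * m - l * m * l - l * m * l + m * m * pcov S Z w w
   = m * (m * pcov S Z w w - l ^+ 2) by ring.
by rewrite pmulr_rge0 // subr_ge0.
Qed.

Variable K : V -> V -> R.
Hypothesis SK : forall u v, \sum_w S u w * K w v = (u == v)%:R.
Hypothesis Ksym : forall u v, K u v = K v u.

(** The analogue of [posdef_eq0] for [K]: with [y = x K] one has [x = y S], and the hypothesis says
    that [x] vanishes wherever [y] does not, so [posdef_eq0] applies to [y]. *)
Lemma inverse_form_eq0 (x : V -> R) :
  (forall w, x w != 0 -> \sum_v x v * K v w = 0) -> forall u, x u = 0.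
Proof.
move=> h u; pose y w := \sum_v x v * K v w.
have xE w : x w = \sum_t y t * S t w.
  rewrite /y; under eq_bigr do rewrite mulr_suml; rewrite exchange_big /=.
  under eq_bigr => v _.
    under eq_bigr => t _ do rewrite -mulrA [K v t]Ksym [_ * S t w]mulrC (Ssym t w).
    rewrite -mulr_sumr SK; over.
  rewrite (bigD1 w) //= eqxx mulr1 big1 ?addr0 // => v /negPf.
  by rewrite eq_sym => ->; rewrite mulr0.
have y0 : forall t, y t = 0.
  apply: posdef_eq0 => t yt; rewrite -xE; apply/eqP; apply: contraNT yt => xt.
  by rewrite /y h.
by rewrite xE big1 // => t _; rewrite y0 mul0r.
Qed.

(* [c] lies outside [A] and [K] has no entry linking [A] to what lies beyond
   [c]: then [c] screens off [a] from everything beyond it, given [Z]. *)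
Lemma pcov_screened (Z : {set V}) (A : pred V) (a b c : V) :
  a \in A -> c \notin A -> b \notin A -> b != c -> c \notin Z -> b \notin Z ->
  (forall v w, v \in A -> w \notin A -> w != c -> K v w = 0) ->
  pcov S Z a b = pcov S Z a c / pcov S Z c c * pcov S Z c b.
Proof.
move=> aA cA bA bc cZ bZ KA.
have [x [xE x0 xd]] := residual_coefs Z a.
have [y [yE y0 yd]] := residual_coefs Z c.
pose l := pcov S Z a c / pcov S Z c c.
(* The covariances with the residual of [a] after [c] has been regressed out as well; the claim is
   [h b = 0]. *)
pose h w := pcov S Z a w - l * pcov S Z c w.
have hc : h c = 0 by rewrite /h /l divfK ?subrr // gt_eqF // pcov_gt0.
have hZ w : w \in Z -> h w = 0 by move=> wZ; rewrite /h x0 // y0 // mulr0 subrr.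
(* Since [h = (x - l y) S], multiplying by [K] returns [x - l y], which is supported on [Z], [a] and
   [c]. *)
have hK w : w \notin Z -> w != a -> w != c -> \sum_v h v * K v w = 0.
  move=> wZ wa wc.
  have hE v : h v = \sum_t (x t - l * y t) * S t v.
    rewrite /h xE yE mulr_sumr -sumrB; apply: eq_bigr => t _; ring.
  under eq_bigr do rewrite hE mulr_suml; rewrite exchange_big /=.
  under eq_bigr => t _.
    under eq_bigr do rewrite -mulrA.
    rewrite -mulr_sumr SK; over.
  rewrite big1 // => t _; have [->|] := eqVneq t w; last by rewrite mulr0.
  by rewrite xd // yd // (negPf wa) (negPf wc) mulr0 subrr mul0r.
(* Truncating [h] to zero on [A] keeps the equations of [hK] wherever the truncation is nonzero, as
   [K] has no entry from [A] to such a point. Hence the truncation vanishes. *)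
suff : (if b \in A then 0 else h b) = 0.
  by rewrite (negPf bA) /h => /eqP; rewrite subr_eq0 => /eqP.
apply: (inverse_form_eq0 (x := fun v => if v \in A then 0 else h v)) => w.
have [|wA hw] := boolP (w \in A); first by rewrite eqxx.
have wZ : w \notin Z by apply: contraNN hw => /hZ ->.
have wc : w != c by apply: contraNneq hw => ->; rewrite hc.
have wa : w != a by apply: contraNneq wA => ->.
rewrite -[RHS](hK w wZ wa wc); apply: eq_bigr => v _.
by case: ifP => // vA; rewrite KA ?mulr0.
Qed.

End PartialCovariance.

Section GaussianMarkov.
Local Open Scope classical_set_scope.
Local Open Scope ring_scope.

(** * Translation of iterated integrals *)

Section LebesgueTranslation.
Variable R : realType.
Notation leb := (@lebesgue_measure R).
Local Open Scope ereal_scope.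

Lemma lebesgue_measure_shift (t : R) (A : set R) : measurable A ->
  pushforward leb (fun x : measurableTypeR R => (x + t)%R : measurableTypeR R) A = leb A.
Proof.
have mphi : measurable_fun setT (fun x : measurableTypeR R => (x + t)%R : measurableTypeR R).
  exact: measurable_funD.
move=> mA; apply/esym; apply: (@lebesgue_measure_unique R (pushforward leb _)) => // X.
case=> -[a b] _ <- /=; rewrite /pushforward.
have -> : (fun x : R => (x + t)%R) @^-1` `]a, b]%classic = `](a - t)%R, (b - t)%R]%classic.
  by apply/seteqP; split => x /=; rewrite !in_itv/= ltrBlDr lerBrDr.
rewrite !lebesgue_measure_itv/= !lte_fin ltrBlDr subrK.
by case: ifP => // _; rewrite -!EFinB; congr (_%:E); ring.
Qed.

(* No measurability is needed below, as the integral of any nonnegative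
   function is the supremum of the integrals of the simple functions under it. *)
Lemma ge0_le_integralT d (T : measurableType d) (mu : {measure set T -> \bar R})
    (f g : T -> \bar R) :
  (forall x, 0 <= f x) -> (forall x, f x <= g x) ->
  \int[mu]_x f x <= \int[mu]_x g x.
Proof.
move=> f0 fg; have g0 x : 0 <= g x by exact: le_trans (f0 x) (fg x).
rewrite !ge0_integralTE //; apply: ereal_sup_le => _ [h hf <-]; exists h => //= x.
exact: le_trans (hf x) (fg x).
Qed.

(** Reduces a bound for an arbitrary nonnegative [f] to measurable real functions below it, where
    the usual integration rules apply. *)
Lemma ge0_integral_leP d (T : measurableType d) (mu : {measure set T -> \bar R})
    (f : T -> \bar R) (M : \bar R) : (forall x, 0 <= f x) ->
  (forall h : T -> R, measurable_fun setT h -> (forall x, (0 <= h x)%R) ->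
     (forall x, (h x)%:E <= f x) -> \int[mu]_x (h x)%:E <= M) ->
  \int[mu]_x f x <= M.
Proof.
move=> f0 H; rewrite ge0_integralTE //; apply: ge_ereal_sup => _ [h hf <-].
have := integral_nnsfun mu (@measurableT _ T) h; rewrite patch_setT => <-.
by apply: H => // x; exact: fun_ge0.
Qed.

Lemma integral_shift (t : R) (f : R -> \bar R) : (forall x, 0 <= f x) ->
  \int[leb]_x f (x + t)%R = \int[leb]_x f x.
Proof.
have mphi s : measurable_fun setT (fun x : measurableTypeR R => (x + s)%R : measurableTypeR R).
  exact: measurable_funD.
have le s (g : R -> \bar R) : (forall x, 0 <= g x) ->
    \int[leb]_x g (x + s)%R <= \int[leb]_x g x.
  move=> g0; apply: ge0_integral_leP => // h mh h0 hg.
  have mhs : measurable_fun setT (fun x : measurableTypeR R => (h (x - s)%R)%:E).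
    apply/measurable_EFinP.
    exact: (measurableT_comp mh (mphi (- s)%R)).
  apply: (@le_trans _ _ (\int[leb]_x (h (x - s)%R)%:E)); last first.
    apply: ge0_le_integralT => x; first by rewrite lee_fin.
    by apply: le_trans (hg _) _; rewrite subrK.
  rewrite le_eqVlt; apply/orP; left; apply/eqP.
  transitivity (\int[pushforward leb (fun x : measurableTypeR R => (x + s)%R : measurableTypeR R)]_(x in setT) (h (x - s)%R)%:E).
    rewrite ge0_integral_pushforward //; last by move=> y _; rewrite lee_fin.
    by apply: eq_integral => x _ /=; rewrite addrK.
  apply: eq_measure_integral => A mA _; exact: lebesgue_measure_shift.
(* The reverse inequality is [le] for the shift [- t], applied to the translate of [f]. *)
move=> f0; apply/eqP; rewrite eq_le le //=.
have := le (- t)%R (fun x => f (x + t)%R) (fun x => f0 _).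
by under eq_integral do rewrite subrK.
Qed.

Lemma ge0_integral_scale_le d (T : measurableType d) (mu : {measure set T -> \bar R})
    (k : R) (f : T -> \bar R) :
  (0 < k)%R -> (forall x, 0 <= f x) ->
  k%:E * \int[mu]_x f x <= \int[mu]_x (k%:E * f x).
Proof.
move=> k0 f0; rewrite -lee_pdivlMl //; apply: ge0_integral_leP => // h mh h0 hf.
rewrite lee_pdivlMl // -ge0_integralZl_EFin //; last first.
  - exact: ltW.
  - exact/measurable_EFinP.
  - by move=> x _; rewrite lee_fin.
apply: ge0_le_integralT => x; first by rewrite -EFinM lee_fin mulr_ge0 // ltW.
by rewrite lee_pmul2l.
Qed.

End LebesgueTranslation.

Section IteratedIntegral.
Variables (R : realType) (V : finType).
Local Open Scope ereal_scope.
Implicit Types (f g : (V -> R) -> \bar R) (x : V -> R).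

Definition coord_shift (u : V) (t : R) x : V -> R :=
  fun w => if w == u then (x w + t)%R else x w.

Lemma iter_integral_ge0 s f x : (forall y, 0 <= f y) -> 0 <= iter_integral s f x.
Proof.
by move=> f0; elim: s x => //= v s IH x; apply: integral_ge0.
Qed.

Lemma iter_integral_le s f g x : (forall y, 0 <= f y) -> (forall y, f y <= g y) ->
  iter_integral s f x <= iter_integral s g x.
Proof.
move=> f0 fg; elim: s x => //= v s IH x; apply: ge0_le_integralT => // t.
exact: iter_integral_ge0.
Qed.

Lemma iter_integral_scale_le s f x (k : R) : (0 < k)%R -> (forall y, 0 <= f y) ->
  k%:E * iter_integral s f x <= iter_integral s (fun y => k%:E * f y) x.
Proof.
move=> k0 f0; elim: s x => //= v s IH x.
apply: le_trans (ge0_integral_scale_le _ k0 _) _ => [t|].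
  exact: iter_integral_ge0.
apply: ge0_le_integralT => // t.
by apply: mule_ge0; [rewrite lee_fin ltW|exact: iter_integral_ge0].
Qed.

(** Integrating over the coordinate [u] absorbs the shift; until then it stays on the base point,
    which is what the conditional records for the induction. *)
Lemma iter_integral_shift s f x u t : (forall y, 0 <= f y) ->
  iter_integral s (f \o coord_shift u t) x =
  iter_integral s f (if u \in s then x else coord_shift u t x).
Proof.
move=> f0; elim: s x => //= v s IH x; rewrite inE eq_sym.
have [-> /=|vu /=] := eqVneq v u.
  under eq_integral do rewrite IH.
  case: (u \in s) => //.
  pose F r := iter_integral s f (fun w => if w == u then r else x w).
  rewrite -[RHS](@integral_shift _ t F) => [|r]; last exact: iter_integral_ge0.
  apply: eq_integral => r _; congr (iter_integral _ _ _); apply/funext => w.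
  by rewrite /coord_shift; case: eqP.
under eq_integral do rewrite IH.
apply: eq_integral => r _; congr (iter_integral _ _ _); case: ifP => // _.
apply/funext => w; rewrite /coord_shift.
by have [->|] := eqVneq w v; rewrite ?(negPf vu).
Qed.

Lemma family_integral_shift f u t : (forall y, 0 <= f y) ->
  family_integral (f \o coord_shift u t) = family_integral f.
Proof. by move=> f0; rewrite /family_integral iter_integral_shift // mem_enum. Qed.

Definition unit_box (lo : V -> R) : set (V -> R) :=
  [set x | forall w, x w \in `[lo w, (lo w + 1)%R]].

Lemma family_integral_box_ge f (lo : V -> R) (m : R) : (0 <= m)%R ->
  (forall y, 0 <= f y) -> (forall y, unit_box lo y -> m%:E <= f y) ->
  m%:E <= family_integral f.
Proof.
move=> m0 f0 fm; rewrite /family_integral.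
(* The induction needs the coordinates not yet integrated to lie in the box; for [enum V] there are
   none. Each integration keeps the bound because the interval has length 1. *)
suff H s x : (forall w, w \notin s -> x w \in `[lo w, (lo w + 1)%R]) ->
    m%:E <= iter_integral s f x by apply: H => w; rewrite mem_enum.
elim: s x => [|v s IH] x hx; first by apply: fm => w; exact: hx.
apply: (@le_trans _ _ (\int[lebesgue_measure]_t (m%:E * (\1_(`[lo v, (lo v + 1)%R]%classic) t)%:E))).
  rewrite ge0_integralZl_EFin //.
    rewrite integral_indic // setIT.
    have leb1 : lebesgue_measure `[lo v, (lo v + 1)%R]%classic = 1.
      by rewrite lebesgue_measure_itv /= lte_fin ltrDl ltr01 -EFinB addrAC subrr add0r.
    by rewrite [X in _ * X]leb1 mule1.
  by apply/measurable_EFinP.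
apply: ge0_le_integralT => t; first by rewrite -EFinM lee_fin mulr_ge0.
rewrite indicE; have [|_] := boolP (t \in _); last first.
  by rewrite mule0; exact: iter_integral_ge0.
rewrite inE /= mule1 => tin; apply: IH => w ws.
by have [->|wv] := eqVneq w v => //; apply: hx; rewrite inE (negPf wv).
Qed.

End IteratedIntegral.

(** * Comparison of conditional probabilities *)

Section ConditionalProbability.
Context (d : measure_display) (T : measurableType d) (R : realType) (P : probability T R).
Variable G : set (set T).
Hypotheses (saG : sigma_algebra setT G) (Gm : G `<=` measurable).
Implicit Types (A C : set T) (g : T -> R).
Local Open Scope ereal_scope.

(** Viewing [G] as the sigma-algebra of a measurable type makes the set the preimage of [true] under
    a measurable comparison. *)
Lemma sigma_algebra_lt_mem (k : R) g g' :
  preimage_set_system setT g measurable `<=` G ->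
  preimage_set_system setT g' measurable `<=` G ->
  G [set w | (k * g' w < g w)%R].
Proof.
pose GT := g_sigma_algebraType G.
have mG (h : T -> R) : preimage_set_system setT h measurable `<=` G ->
    measurable_fun setT (h : GT -> R).
  move=> hG _ Y mY; rewrite -[measurable]/(<<s G >>) sigma_algebra_id //.
  by apply: hG; exists Y.
move=> /mG gG /mG gG'.
have := measurable_fun_ltr (measurable_funM (measurable_cst k) gG') gG.
move=> /(_ measurableT [set true] I); rewrite setTI.
by rewrite -[measurable]/(<<s G >>) sigma_algebra_id.
Qed.

(** The part [D] of [C] where [g] exceeds [k * g'] is in [G], so the integral of [g - k * g'] over
    [D] is at most 0. As the integrand is positive there, [D] is null. *)
Lemma cond_prob_ae_le A A' C g g' (k : R) : G C ->
  cond_prob P G A g -> cond_prob P G A' g' ->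
  (forall C', G C' -> C' `<=` C -> P (A `&` C') <= k%:E * P (A' `&` C')) ->
  {ae P, forall w, C w -> (g w <= k * g' w)%R}.
Proof.
move=> GC [gG gI gP] [gG' gI' gP'] AA'.
pose D := C `&` [set w | (k * g' w < g w)%R].
have GD : G D.
  rewrite -(sigma_algebra_id saG); apply: (@measurableI _ (g_sigma_algebraType G)).
    exact: sub_sigma_algebra.
  by apply: sub_sigma_algebra; exact: sigma_algebra_lt_mem.
have mD : measurable D by exact: Gm.
have mint (h : T -> R) : P.-integrable setT (EFin \o h) -> P.-integrable D (EFin \o h).
  by apply: integrableS.
have kI : P.-integrable D (EFin \o (fun w => k * g' w)%R).
  have := integrableZl mD k (mint _ gI').
  by apply: eq_integrable => // w _; rewrite /= EFinM.
have I0 : \int[P]_(w in D) ((g w)%:E - (k * g' w)%:E) <= 0.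
  rewrite integralB_EFin //; last exact: mint.
  rewrite lee_subel_addr // add0e.
  rewrite gP //; apply: le_trans (AA' _ GD (@subIsetl _ _ _)) _.
  rewrite -gP' // -integralZl //; last exact: mint.
have aeD : ae_eq P D (fun w => (g w)%:E - (k * g' w)%:E) (cst 0).
  apply/ae_eq_integral_abs => //.
    by case/integrableP: (integrableB mD (mint _ gI) kI).
  apply/eqP; rewrite eq_le integral_ge0 // andbT.
  apply: le_trans I0; rewrite le_eqVlt; apply/orP; left; apply/eqP.
  apply: eq_integral => w; rewrite inE => -[_ /= lt].
  by rewrite /= ger0_norm // subr_ge0 ltW.
apply: filterS aeD => w Dw Cw; rewrite leNgt; apply/negP => lt.
have /= := Dw (conj Cw lt); rewrite -EFinB => -[] /eqP.
by rewrite subr_eq0 => /eqP E; rewrite E ltxx in lt.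
Qed.

Lemma cond_prob_ae_unique A g g' :
  cond_prob P G A g -> cond_prob P G A g' -> {ae P, forall w, g w = g' w}.
Proof.
move=> gA gA'; have GT : G setT.
  by have [G0 /(_ _ G0)] := saG; rewrite setD0.
have := cond_prob_ae_le (k := 1) GT gA' gA; have := cond_prob_ae_le (k := 1) GT gA gA'.
move=> /(_ (fun C' _ _ => _)) h1 /(_ (fun C' _ _ => _)) h2.
apply: filterS2 (h1 _) (h2 _) => [w|C|C]; rewrite ?mul1e //.
by rewrite !mul1r => /(_ I) le1 /(_ I) le2; apply/eqP; rewrite eq_le le1.
Qed.

Lemma cond_prob_ae_le0 A C g : G C -> cond_prob P G A g ->
  {ae P, forall w, C w -> (g w <= 0)%R} -> P (A `&` C) <= 0.
Proof.
move=> GC [_ gI gP] g0; have mC := Gm GC.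
rewrite -gP // integralE.
have mg : measurable_fun C (EFin \o g).
  by apply: measurable_funS (measurable_int _ gI).
rewrite (ae_eq_integral (cst 0)) //=.
- by rewrite integral0 sub0e oppe_le0 integral_ge0.
- exact: measurable_funepos.
- apply: filterS g0 => w gw /gw {}gw /=; rewrite funeposE.
  by apply/max_idPr; rewrite lee_fin.
Qed.

(* Given [A2] the event [A1'] is at least [1 / p] times as likely as [A1], given
   [A2'] at most [q < 1 / p] times; under conditional independence both ratios
   are the same, so [A1 `&` A2] must be null. *)
Lemma cond_indep_ratio_null (F1 F2 : set (set T)) (A1 A1' A2 A2' C : set T) (p q k : R) :
  cond_indep P F1 F2 G -> F1 A1 -> F1 A1' -> F2 A2 -> F2 A2' -> G C ->
  (0 < p)%R -> (0 < k)%R -> (p * q < 1)%R ->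
  (forall C', G C' -> C' `<=` C ->
     [/\ P ((A1 `&` A2) `&` C') <= p%:E * P ((A1' `&` A2) `&` C'),
         P ((A1' `&` A2') `&` C') <= q%:E * P ((A1 `&` A2') `&` C') &
         P ((A1 `&` A2) `&` C') <= k%:E * P ((A1 `&` A2') `&` C')]) ->
  P ((A1 `&` A2) `&` C) <= 0.
Proof.
move=> ci F1A F1A' F2A F2A' GC p0 k0 pq H.
have [a1 [b1 [c1 [ha1 hb1 hc1 e1]]]] := ci _ _ F1A F2A.
have [a2 [b2 [c2 [ha2 hb2 hc2 e2]]]] := ci _ _ F1A' F2A.
have [a3 [b3 [c3 [ha3 hb3 hc3 e3]]]] := ci _ _ F1A F2A'.
have [a4 [b4 [c4 [ha4 hb4 hc4 e4]]]] := ci _ _ F1A' F2A'.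
have h12 := cond_prob_ae_le GC hc1 hc2 (fun C' GC' CC' => let: And3 h _ _ := H C' GC' CC' in h).
have h43 := cond_prob_ae_le GC hc4 hc3 (fun C' GC' CC' => let: And3 _ h _ := H C' GC' CC' in h).
have h13 := cond_prob_ae_le GC hc1 hc3 (fun C' GC' CC' => let: And3 _ _ h := H C' GC' CC' in h).
apply: (cond_prob_ae_le0 GC hc1).
(* Each use of [ci] brings its own versions; those of the same event agree almost surely. *)
have a13 := cond_prob_ae_unique ha1 ha3; have a24 := cond_prob_ae_unique ha2 ha4.
have b12 := cond_prob_ae_unique hb1 hb2; have b34 := cond_prob_ae_unique hb3 hb4.
near=> w => Cw.
have f1 : c1 w = (a1 w * b1 w)%R by near: w.
have f2 : c2 w = (a2 w * b1 w)%R by near: w; apply: filterS2 e2 b12 => w -> ->.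
have f3 : c3 w = (a1 w * b3 w)%R by near: w; apply: filterS2 e3 a13 => w -> ->.
have f4 : c4 w = (a2 w * b3 w)%R.
  by near: w; apply: filterS3 e4 a24 b34 => w -> -> ->.
have h1 : (c1 w <= p * c2 w)%R by move: Cw; near: w.
have h2 : (c4 w <= q * c3 w)%R by move: Cw; near: w.
have h3 : (c1 w <= k * c3 w)%R by move: Cw; near: w.
move: h1 h2 h3; rewrite f1 f2 f3 f4 => h1 h2 h3.
rewrite leNgt; apply/negP => pos.
(* The bound with [k] serves only here: it makes [c3 w] positive together with [c1 w], so that the
   product of the two bounds below contradicts [p * q < 1]. *)
have pos' : (0 < a1 w * b3 w)%R by rewrite -(pmulr_rgt0 _ k0); exact: lt_le_trans h3.
have : ((a1 w * b1 w) * (a1 w * b3 w) <= (p * q) * ((a1 w * b1 w) * (a1 w * b3 w)))%R.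
  apply: (@le_trans _ _ (p * (a2 w * b1 w) * (a1 w * b3 w))%R).
    by rewrite ler_pM2r.
  have -> : (p * (a2 w * b1 w) * (a1 w * b3 w) = p * (a1 w * b1 w) * (a2 w * b3 w))%R by ring.
  have -> : (p * q * (a1 w * b1 w * (a1 w * b3 w)) = p * (a1 w * b1 w) * (q * (a1 w * b3 w)))%R by ring.
  by rewrite ler_pM2l // mulr_gt0.
rewrite leNgt -[ltRHS]mul1r ltr_pM2r ?pq //; exact: mulr_gt0.
Unshelve. all: by end_near. Qed.

End ConditionalProbability.

(** * Zeros of the precision matrix *)

Lemma sigma_of_mem (T : Type) (R : realType) (V : finType) (X : V -> T -> R)
    (A : {set V}) v (B : set R) :
  v \in A -> measurable B ->
  sigma_of X A (X v @^-1` B).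
Proof.
move=> vA mB; apply: sub_sigma_algebra; exists v => //; exists B => //.
by rewrite setTI.
Qed.

Section SigmaOf.
Context (d : measure_display) (T : measurableType d) (R : realType) (V : finType).
Implicit Types (X : V -> T -> R) (A : {set V}).

Lemma sigma_of_measurable X A :
  (forall v, measurable_fun setT (X v)) -> sigma_of X A `<=` measurable.
Proof.
move=> mX; apply: smallest_sub; first exact: sigma_algebra_measurable.
by move=> _ [v _ [B mB <-]]; exact: mX.
Qed.

(** Events of this form are a sigma-algebra containing the generators. The last clause makes [B]
    invariant under shifts of coordinates outside [A]. *)
Lemma sigma_of_pullback X A (C : set T) : sigma_of X A C ->
  exists B : set (V -> R), [/\ borel_family B, C = (fun w v => X v w) @^-1` B &
    forall x y, (forall v, v \in A -> x v = y v) -> B x -> B y].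
Proof.
set XX := fun w v => X v w.
pose Q := [set C : set T | exists B : set (V -> R), [/\ borel_family B, C = XX @^-1` B &
    forall x y, (forall v, v \in A -> x v = y v) -> B x -> B y]].
suff : sigma_of X A `<=` Q by apply.
apply: smallest_sub.
  split.
  - by exists set0; split => //; apply: sigma_algebra0.
  - move=> _ [B [mB -> BA]]; exists (~` B); split.
    + by rewrite -setTD; apply: sigma_algebraCD.
    + by rewrite setTD.
    + by move=> x y xy nBx By; apply: nBx; apply: BA By => v vA; rewrite xy.
  - move=> F /choice[B HB]; exists (\bigcup_k B k); split.
    + by apply: sigma_algebra_bigcup => i; case: (HB i).
    + rewrite preimage_bigcup; apply: eq_bigcupr => i _; by case: (HB i).
    + by move=> x y xy [i _ Bx]; exists i => //; case: (HB i) => _ _; apply; [exact: xy|].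
move=> _ [v vA [Y mY <-]]; exists [set x | Y (x v)]; split.
- by apply: (@sigma_of_mem _ _ _ (fun v x => x v) [set: V]%SET v Y).
- by rewrite setTI.
- by move=> x y xy /=; rewrite xy.
Qed.

End SigmaOf.

(** The missing inequality is [iter_integral_scale_le] for the factor [k^-1]. *)
Lemma family_integral_scale (R : realType) (V : finType) (f : (V -> R) -> \bar R) (k : R) :
  0 < k -> (forall y, (0 <= f y)%E) ->
  family_integral (fun y => k%:E * f y)%E = (k%:E * family_integral f)%E.
Proof.
move=> k0 f0; apply/eqP; rewrite eq_le iter_integral_scale_le // andbT.
rewrite -lee_pdivrMl //.
apply: le_trans (iter_integral_scale_le _ _ _ _) _; rewrite ?invr_gt0 //.
  by move=> y; rewrite mule_ge0 // lee_fin ltW.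
by apply: iter_integral_le => y; rewrite muleA -EFinM mulVf ?gt_eqF // mul1e.
Qed.

Lemma family_integral0 (R : realType) (V : finType) :
  family_integral (fun _ : V -> R => 0%E : \bar R) = 0%E.
Proof.
suff H s (x : V -> R) : iter_integral s (fun=> 0%E : \bar R) x = 0%E by exact: H.
elim: s x => //= v s IH x.
by under eq_integral do rewrite IH; exact: integral0.
Qed.

Lemma coord_shift_box (R : realType) (V : finType) (lo x : V -> R) u t :
  unit_box (coord_shift u t lo) (coord_shift u t x) <-> unit_box lo x.
Proof.
have E w : (coord_shift u t x w \in `[coord_shift u t lo w, coord_shift u t lo w + 1])
    = (x w \in `[lo w, lo w + 1]).
  by rewrite /coord_shift; case: eqP; rewrite // !in_itv /= addrAC !lerD2r.
by split=> h w; have := h w; rewrite E.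
Qed.

Section QuadraticForm.
Variables (R : realType) (V : finType) (K : V -> V -> R) (mu : V -> R).
Hypothesis Ksym : forall u v, K u v = K v u.

(** Half the derivative of [centered_form] in the coordinate [u], for symmetric [K]. *)
Definition centered_row (u : V) (x : V -> R) : R := \sum_w K u w * (x w - mu w).

Definition centered_form (x : V -> R) : R :=
  \sum_v \sum_w (x v - mu v) * K v w * (x w - mu w).

Lemma centered_form_shift u t x : centered_form (coord_shift u t x) =
  centered_form x + 2 * t * centered_row u x + t ^+ 2 * K u u.
Proof.
have dE w : coord_shift u t x w - mu w = (x w - mu w) + (w == u)%:R * t.
  by rewrite /coord_shift; case: eqP => _; rewrite ?mul1r ?mul0r ?addr0 // addrAC.
have delta (F : V -> R) : \sum_w (w == u)%:R * F w = F u.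
  rewrite (bigD1 u) //= eqxx mul1r big1 ?addr0 // => w /negPf ->.
  by rewrite mul0r.
rewrite /centered_form.
transitivity (\sum_v ((x v - mu v) * (centered_row v x + t * K v u)
   + (v == u)%:R * (t * (centered_row v x + t * K v u)))).
  apply: eq_bigr => v _.
  transitivity (\sum_w ((x v - mu v + (v == u)%:R * t) * (K v w * (x w - mu w))
     + (w == u)%:R * ((x v - mu v + (v == u)%:R * t) * K v w * t))).
    by apply: eq_bigr => w _; rewrite !dE; ring.
  by rewrite big_split /= -mulr_sumr -/(centered_row v x) delta; ring.
rewrite big_split /= delta.
have -> : \sum_v (x v - mu v) * (centered_row v x + t * K v u) =
    centered_form x + t * centered_row u x.
  under eq_bigr do rewrite mulrDr; rewrite big_split /=; congr (_ + _).
    apply: eq_bigr => v _; rewrite mulr_sumr; apply: eq_bigr => w _; ring.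
  rewrite mulr_sumr; apply: eq_bigr => v _; rewrite (Ksym v u); ring.
rewrite /centered_form; ring.
Qed.

Lemma unit_box_dist (lo x : V -> R) w :
  unit_box lo x -> `|x w - mu w| <= `|lo w| + 1 + `|mu w|.
Proof.
move=> /(_ w); rewrite in_itv /= => /andP[h1 h2].
rewrite (le_trans (ler_normB _ _)) // lerD2r.
have -> : x w = lo w + (x w - lo w) by ring.
rewrite (le_trans (ler_normD _ _)) // lerD2l ger0_norm ?subr_ge0 //.
by rewrite lerBlDl.
Qed.

Lemma centered_row_bounded (lo : V -> R) u :
  exists M, forall x, unit_box lo x -> `|centered_row u x| <= M.
Proof.
exists (\sum_w `|K u w| * (`|lo w| + 1 + `|mu w|)) => x xl.
apply: le_trans (ler_norm_sum _ _ _) _; apply: ler_sum => w _.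
by rewrite normrM ler_wpM2l // unit_box_dist.
Qed.

Lemma centered_form_bounded (lo : V -> R) :
  exists M, forall x, unit_box lo x -> `|centered_form x| <= M.
Proof.
exists (\sum_v \sum_w (`|lo v| + 1 + `|mu v|) * `|K v w| * (`|lo w| + 1 + `|mu w|)) => x xl.
apply: le_trans (ler_norm_sum _ _ _) _; apply: ler_sum => v _.
apply: le_trans (ler_norm_sum _ _ _) _; apply: ler_sum => w _.
rewrite !normrM ler_pM ?mulr_ge0 ?unit_box_dist //.
by rewrite ler_wpM2r // unit_box_dist.
Qed.

End QuadraticForm.

(** [K] is the inverse matrix with its indices transported to [V]. Only [0 <= c] is claimed, which
    spares the sign of the determinant; positivity comes from the total mass in [c_gt0]. *)
Lemma gauss_pdf_formE (R : realType) (V : finType) (S : V -> V -> R) : posdef S ->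
  exists K : V -> V -> R,
    [/\ forall u v, K u v = K v u,
        forall u v, \sum_w S u w * K w v = (u == v)%:R &
        forall mu, exists2 c, 0 <= c & forall x,
          gauss_pdf mu S x = c * expR (- 2^-1 * centered_form K mu x)].
Proof.
move=> Spd; pose M := block S [set: V]%SET [set: V]%SET.
pose rk v := enum_rank_in (finset.in_setT v) v : 'I_#|[set: V]%SET|.
have rkK v : enum_val (rk v) = v by rewrite enum_rankK_in ?finset.in_setT.
have rkV i : rk (enum_val i) = i by rewrite /rk enum_valK_in.
have sumE (F : V -> R) : \sum_w F w = \sum_(i < #|[set: V]%SET|) F (enum_val i).
  by rewrite -big_enum_val; apply: eq_bigl => w; rewrite finset.in_setT.
exists (fun u v => invmx M (rk u) (rk v)); split.
- move=> u v; have MT : M^T = M by apply/matrixP => i j; rewrite !mxE Spd.1.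
  by rewrite -[in LHS]MT -trmx_inv mxE.
- move=> u v; rewrite sumE.
  transitivity ((M *m invmx M) (rk u) (rk v)).
    by rewrite mxE; apply: eq_bigr => i _; rewrite rkV mxE rkK.
  by rewrite mulmxV ?block_unit // mxE (can_eq rkK).
move=> mu; exists (Num.sqrt ((2 * pi) ^+ #|V| * \det M))^-1.
  by rewrite invr_ge0 sqrtr_ge0.
move=> x; rewrite /gauss_pdf -/M; congr (_ * expR (_ * _)).
rewrite mxE /centered_form sumE.
under eq_bigr do rewrite mxE mulr_suml.
rewrite exchange_big /=; apply: eq_bigr => i _; rewrite sumE; apply: eq_bigr => j _.
by rewrite !mxE !rkV.
Qed.

Lemma borel_family_box (R : realType) (V : finType) (lo : V -> R) (B : set (V -> R)) :
  borel_family B -> borel_family (unit_box lo `&` B).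
Proof.
move=> mB.
pose G := \bigcup_(v in [set` [set: V]%SET])
  preimage_set_system setT (fun x : V -> R => x v) measurable.
apply: (@measurableI _ (g_sigma_algebraType G)) => //.
have -> : unit_box lo =
    \bigcap_(w in [set: V]) (fun x : V -> R => x w) @^-1` `[lo w, lo w + 1]%classic.
  by apply/seteqP; split => [x h w _|x h w]; [exact: h|exact: (h w I)].
apply: (@fin_bigcap_measurable _ (g_sigma_algebraType G)) => [|w _].
  exact: finite_finset.
exact: (@sigma_of_mem _ _ _ (fun v x => x v) [set: V]%SET w `[lo w, lo w + 1]%classic).
Qed.

Section Precision.
Context (d : measure_display) (T : measurableType d) (R : realType)
  (P : probability T R) (V : finType) (X : V -> {RV P >-> R}) (mu : V -> R)
  (S K : V -> V -> R) (c : R).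
Hypotheses (Ksym : forall u v, K u v = K v u) (c_ge0 : 0 <= c)
  (pdfE : forall x, gauss_pdf mu S x = c * expR (- 2^-1 * centered_form K mu x))
  (gX : gaussian_vector X mu S).

Let Q (B : set (V -> R)) := P ((fun w v => X v w) @^-1` B).
Let f := gauss_pdf mu S.

Let f_ge0 x : 0 <= f x.
Proof. by rewrite /f pdfE mulr_ge0 // expR_ge0. Qed.

Let QE (B : set (V -> R)) : borel_family B ->
  Q B = family_integral (fun x => (\1_B x * f x)%:E).
Proof. exact: gX. Qed.

Let F_ge0 (B : set (V -> R)) x : (0 <= (\1_B x * f x)%:E)%E.
Proof. by rewrite lee_fin mulr_ge0. Qed.

Let pdf_shift u t x : f (coord_shift u t x) =
  expR (- (t * centered_row K mu u x + 2^-1 * t ^+ 2 * K u u)) * f x.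
Proof.
by rewrite /f !pdfE mulrCA -expRD centered_form_shift //; congr (_ * expR _); field.
Qed.

(** As [B] is invariant, the shift carries one set onto the other, and by translation invariance a
    pointwise comparison of densities becomes one of probabilities. *)
Let box_shift_le u t lo (B : set (V -> R)) k : 0 < k -> borel_family B ->
  (forall x, B (coord_shift u t x) <-> B x) ->
  (forall x, unit_box lo x -> f (coord_shift u t x) <= k * f x) ->
  (Q (unit_box (coord_shift u t lo) `&` B) <= k%:E * Q (unit_box lo `&` B))%E.
Proof.
move=> k0 mB Binv fk; rewrite !QE; try exact: borel_family_box.
rewrite -(family_integral_shift u t) // -family_integral_scale //.
apply: iter_integral_le => [y|x]; first exact: F_ge0.
rewrite /comp -EFinM lee_fin !indicE.
have -> : (coord_shift u t x \in unit_box (coord_shift u t lo) `&` B) =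
    (x \in unit_box lo `&` B).
  by apply/idP/idP; rewrite !inE => -[/coord_shift_box ? /Binv ?].
have [|_] := boolP (x \in _); last by rewrite !mul0r mulr0.
by rewrite inE !mul1r => -[/fk].
Qed.

Let box_shift_ge u t lo (B : set (V -> R)) k : 0 < k -> borel_family B ->
  (forall x, B (coord_shift u t x) <-> B x) ->
  (forall x, unit_box lo x -> f x <= k * f (coord_shift u t x)) ->
  (Q (unit_box lo `&` B) <= k%:E * Q (unit_box (coord_shift u t lo) `&` B))%E.
Proof.
move=> k0 mB Binv fk; rewrite !QE; try exact: borel_family_box.
rewrite -[X in (_ <= _ * X)%E](family_integral_shift u t) // -family_integral_scale //;
  last by move=> y; exact: F_ge0.
apply: iter_integral_le => [y|x]; first exact: F_ge0.
rewrite /comp -EFinM lee_fin !indicE.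
have -> : (coord_shift u t x \in unit_box (coord_shift u t lo) `&` B) =
    (x \in unit_box lo `&` B).
  by apply/idP/idP; rewrite !inE => -[/coord_shift_box ? /Binv ?].
have [|_] := boolP (x \in _); last by rewrite !mul0r mulr0.
by rewrite inE !mul1r => -[/fk].
Qed.

Let borel_setT : borel_family [set: V -> R].
Proof. exact: (@measurableT _ (g_sigma_algebraType _)). Qed.

Let c_gt0 : 0 < c.
Proof.
rewrite lt_neqAle c_ge0 andbT eq_sym; apply/eqP => c0.
have := QE borel_setT; rewrite /Q preimage_setT probability_setT.
have -> : (fun x => (\1_[set: V -> R] x * f x)%:E) = (fun=> 0%E : \bar R).
  by apply/funext => x; rewrite /f pdfE c0 mul0r mulr0.
by rewrite family_integral0 => -[] /eqP; rewrite oner_eq0.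
Qed.

Let Q_box_gt0 lo : (0 < Q (unit_box lo))%E.
Proof.
have [M hM] := centered_form_bounded K mu lo.
rewrite -[unit_box lo]setIT QE; last exact: borel_family_box.
apply: (@lt_le_trans _ _ (c * expR (- 2^-1 * M))%:E).
  by rewrite lte_fin mulr_gt0 // expR_gt0.
apply: family_integral_box_ge => [| |x xl].
- by rewrite mulr_ge0 // expR_ge0.
- exact: F_ge0.
rewrite lee_fin setIT indicE mem_set // mul1r /f pdfE ler_pM2l // ler_expR.
rewrite !mulNr lerN2 ler_pM2l ?invr_gt0 //.
exact: le_trans (ler_norm _) (hM _ xl).
Qed.

Lemma precision_eq0 u v : u != v ->
  cond_indep P (sigma_of X [set u]%SET) (sigma_of X [set v]%SET)
    (sigma_of X (~: [set u; v])%SET) ->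
  K u v = 0.
Proof.
move=> uv ci; apply/eqP/negP => /negP kn0.
set G := sigma_of X (~: [set u; v])%SET in ci.
pose kap := K u v.
(* [y] is so large that on the boxes below the cross term [K u v * x v]
   dominates the rest of [centered_row u x]. *)
pose M := \sum_(w | w != v) `|K u w| * (1 + `|mu w|) + `|kap| * `|mu v|.
pose y := (M + 1 + `|kap|) / kap; pose s := 2 * y.
(* Lower corners of four unit boxes. The first digit tells whether [u] ranges over [[0, 1]] or
   [[1, 2]], the second whether [v] starts at [- y] or at [y]; all other coordinates are in
   [[0, 1]]. *)
pose l00 : V -> R := fun w => if w == v then - y else 0.
pose l10 := coord_shift u 1 l00; pose l01 := coord_shift v s l00.
pose l11 := coord_shift u 1 l01.
have row_near x : (forall w, w != v -> x w \in `[0, 1]) ->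
    `|centered_row K mu u x - kap * x v| <= M.
  move=> hx; rewrite /centered_row (bigD1 v) //= -/kap.
  have -> : kap * (x v - mu v) + \sum_(i | i != v) K u i * (x i - mu i) - kap * x v
    = \sum_(i | i != v) K u i * (x i - mu i) - kap * mu v by ring.
  rewrite (le_trans (ler_normB _ _)) // normrM lerD2r.
  apply: le_trans (ler_norm_sum _ _ _) _; apply: ler_sum => w wv.
  rewrite normrM ler_wpM2l // (le_trans (ler_normB _ _)) // lerD2r.
  by have := hx w wv; rewrite in_itv /= => /andP[? ?]; rewrite ger0_norm.
have kapy : kap * y = M + 1 + `|kap| by rewrite /y mulrC divfK.
have row00 x : unit_box l00 x -> centered_row K mu u x <= - 1.
  move=> xl; have /row_near : forall w, w != v -> x w \in `[0, 1].
    by move=> w /negPf wv; have := xl w; rewrite /l00 wv add0r.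
  rewrite ler_norml => /andP[_ h].
  have : `|kap * (x v + y)| <= `|kap|.
    rewrite normrM ler_piMr //; have := xl v; rewrite /l00 eqxx in_itv /= => /andP[h1 h2].
    by rewrite ger0_norm; lra.
  by rewrite ler_norml mulrDr kapy => /andP[_ h']; lra.
have row01 x : unit_box l01 x -> 1 <= centered_row K mu u x.
  move=> xl; have /row_near : forall w, w != v -> x w \in `[0, 1].
    by move=> w /negPf wv; have := xl w; rewrite /l01 /coord_shift /l00 wv add0r.
  rewrite ler_norml => /andP[h _].
  have : `|kap * (x v - y)| <= `|kap|.
    rewrite normrM ler_piMr //; have := xl v.
    rewrite /l01 /coord_shift /l00 eqxx in_itv /= /s => /andP[h1 h2].
    by rewrite ger0_norm; lra.
  by rewrite ler_norml mulrBr kapy => /andP[h' _]; lra.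
pose It (l : R) : set R := `[l, l + 1]%classic.
have mIt l : measurable (It l) by exact: measurable_itv.
pose A (w : V) (l : V -> R) := X w @^-1` It (l w).
pose C := \bigcap_(w in [set` (~: [set u; v])%SET]) X w @^-1` It 0.
have GC : G C.
  rewrite -[G]/(<<s _ >>); apply: (@fin_bigcap_measurable _ (g_sigma_algebraType _)).
    exact: finite_finset.
  by move=> w wuv; apply: (@sigma_of_mem T R V (fun v => X v)).
have boxE (lo : V -> R) (B : set (V -> R)) : (forall w, w != u -> w != v -> lo w = 0) ->
    (fun w v => X v w) @^-1` B `<=` C ->
    P ((A u lo `&` A v lo) `&` ((fun w v => X v w) @^-1` B)) = Q (unit_box lo `&` B).
  move=> lo0 BC; congr (P _); apply/seteqP; split.
    move=> w [[Au Av] Bw]; split => //= z.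
    have [->|zu] := eqVneq z u; first exact: Au.
    have [->|zv] := eqVneq z v; first exact: Av.
    rewrite lo0 //; apply: (BC w Bw z).
    by rewrite /= !inE negb_or zu zv.
  by move=> w [bw Bw]; split => //; split; [exact: (bw u)|exact: (bw v)].
have lo00 w : w != u -> w != v -> l00 w = 0 by rewrite /l00 => _ /negPf ->.
have lo01 w : w != u -> w != v -> l01 w = 0.
  by rewrite /l01 /coord_shift /l00 => _ /negPf ->.
have lo10 w : w != u -> w != v -> l10 w = 0.
  by rewrite /l10 /coord_shift /l00 => /negPf -> /negPf ->.
have lo11 w : w != u -> w != v -> l11 w = 0.
  by rewrite /l11 /l01 /coord_shift /l00 => /negPf -> /negPf ->.
have vu : v == u = false by rewrite eq_sym (negPf uv).
have A10 : A v l10 = A v l00 by rewrite /A /l10 /coord_shift vu.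
have A01 : A u l01 = A u l00 by rewrite /A /l01 /coord_shift (negPf uv).
have A11u : A u l11 = A u l10.
  by rewrite /A /l11 /l10 /l01 /coord_shift eqxx (negPf uv).
have A11v : A v l11 = A v l01 by rewrite /A /l11 /coord_shift vu.
pose h := 2^-1 * K u u.
have [N hN] := centered_row_bounded K mu l00 v.
pose k := expR (`|s| * N + 2^-1 * s ^+ 2 * K v v).
have saG : sigma_algebra setT G by exact: smallest_sigma_algebra.
have Gm : G `<=` measurable by apply: sigma_of_measurable => w; exact: measurable_funPT.
(* This event says that [X] lies in the box at [l00], which has positive probability. *)
suff : (P ((A u l00 `&` A v l00) `&` C) <= 0)%E.
  have [B [mB CE BA]] := sigma_of_pullback GC.
  rewrite CE boxE -?CE // => hB; have := Q_box_gt0 l00; rewrite ltNge => /negP; apply.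
  apply: le_trans hB; rewrite le_eqVlt; apply/orP; left; apply/eqP; congr (P _).
  apply/seteqP; split => w; last by case.
  move=> bw; split => //; have : C w; last by rewrite CE.
  move=> z /=; rewrite !inE negb_or => /andP[zu zv].
  by have := bw z; rewrite lo00.
(* A unit shift in [u] multiplies the density by [expR (- (row + h))], with row at most -1 near
   [- y] and at least 1 near [y]. The terms [h] cancel in the product of the two constants, leaving
   [expR (- 2) < 1]. *)
apply: (@cond_indep_ratio_null _ _ _ P G saG Gm _ _ (A u l00) (A u l10) (A v l00) (A v l01)
  C (expR (h - 1)) (expR (- h - 1)) k ci); rewrite ?expR_gt0 //.
- by apply: (@sigma_of_mem T R V (fun v => X v)); rewrite ?finset.in_set1 //.
- by apply: (@sigma_of_mem T R V (fun v => X v)); rewrite ?finset.in_set1 //.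
- by apply: (@sigma_of_mem T R V (fun v => X v)); rewrite ?finset.in_set1 //.
- by apply: (@sigma_of_mem T R V (fun v => X v)); rewrite ?finset.in_set1 //.
- by rewrite -expRD expR_lt1; lra.
move=> C' GC' C'C; have [B [mB CE BA]] := sigma_of_pullback GC'.
have BC : (fun w v => X v w) @^-1` B `<=` C by rewrite -CE.
(* [C'] is generated by the coordinates other than [u] and [v], so neither shift affects [B]. *)
have Binv z t : z \in [set u; v]%SET -> forall x, B (coord_shift z t x) <-> B x.
  move=> zuv x; split; apply: BA => w wuv; rewrite /coord_shift; case: eqP => // E;
    by move: wuv; rewrite E finset.inE zuv.
have Bu t : forall x, B (coord_shift u t x) <-> B x by apply: Binv; rewrite !inE eqxx.
have Bv t : forall x, B (coord_shift v t x) <-> B x by apply: Binv; rewrite !inE eqxx orbT.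
have P00 := @boxE l00 B lo00 BC; have P10 := @boxE l10 B lo10 BC.
have P01 := @boxE l01 B lo01 BC; have P11 := @boxE l11 B lo11 BC.
rewrite A10 in P10; rewrite A01 in P01; rewrite A11u A11v in P11.
rewrite CE P00 P10 P01 P11; split.
- apply: box_shift_ge => // [|x xl]; first exact: expR_gt0.
  rewrite pdf_shift mulrA -expRD ler_peMl // -[leLHS]expR0 ler_expR.
  by have := row00 _ xl; rewrite /h; lra.
- apply: box_shift_le => // [|x xl]; first exact: expR_gt0.
  rewrite pdf_shift ler_wpM2r // ler_expR.
  by have := row01 _ xl; rewrite /h; lra.
- apply: box_shift_ge => // [|x xl]; first exact: expR_gt0.
  rewrite pdf_shift mulrA -expRD ler_peMl // -[leLHS]expR0 ler_expR.
  suff : s * centered_row K mu v x <= `|s| * N by lra.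
  by rewrite (le_trans (ler_norm _)) // normrM ler_wpM2l // hN.
Qed.

End Precision.

End GaussianMarkov.

(** * The inequality *)

Theorem theorem6 (d : measure_display) (T : measurableType d) (R : realType)
    (P : probability T R) (V : finType) (e : rel V) (X : V -> {RV P >-> R})
    (mu : V -> R) (Sigma : V -> V -> R)
    (hG : gaussian_tree e X mu Sigma)
    (a c c' : V) (hac : a <> c)
    (p : seq V) (hp : gpath e a c' p) (hc : c \in a :: p)
    (Z : {set V}) (hZ : Z \subset ~: [set a; c; c']%SET) :
  sq_pcorr Sigma Z a c' <= sq_pcorr Sigma Z a c.
Proof.
have [tree_e Spd gX markov] := hG; have [sym_e _ _ acyc] := tree_e.
have [->|cc'] := eqVneq c c'; first exact: lexx.
have ac : a != c by apply/eqP.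
have cp : c \in p by move: hc; rewrite inE eq_sym (negPf ac).
have notZ x : x \in [set a; c; c']%SET -> x \notin Z.
  by move=> xs; apply/negP => /(fintype.subsetP hZ); rewrite finset.in_setC xs.
have [aZ [cZ c'Z]] : a \notin Z /\ c \notin Z /\ c' \notin Z.
  by split; [|split]; apply: notZ; rewrite !finset.inE eqxx ?orbT.
have [K [Ksym SK pdfE]] := gauss_pdf_formE Spd.
have K0 u v : u != v -> ~~ e u v -> K u v = 0.
  have [k k0 kE] := pdfE mu; move=> uv nuv; apply: (precision_eq0 Ksym k0 kE gX uv).
  by have [*] := pairwise_separates uv nuv; exact: markov.
have := acyclic_cut_vertex sym_e acyc hp cp cc'.
set g := [rel x y | e x y && (y != c)] => nac'.
have scr : pcov Sigma Z a c' = pcov Sigma Z a c / pcov Sigma Z c c * pcov Sigma Z c c'.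
  (* The set [A] consists of the vertices reachable from [a] without entering [c]. An edge from it
     to a vertex other than [c] stays inside, so [K0] gives the required zeros. *)
  apply: (@pcov_screened _ _ _ Spd K SK Ksym Z [pred x | connect g a x]) => //.
  - by rewrite inE connect0.
  - rewrite inE; apply/negP => /connectP[s]; case/lastP: s => [_ /eqP|s x].
      by rewrite eq_sym (negPf ac).
    by rewrite rcons_path last_rcons => /and3P[_ _ /eqP xc] E; apply: xc.
  - by rewrite eq_sym.
  - move=> v w; rewrite !inE => av naw wc; apply: K0.
      by apply: contraNneq naw => <-.
    apply: contraNN naw => evw; apply: connect_trans av (connect1 _).
    by rewrite /= evw.
have caa := pcov_gt0 Spd aZ; have ccc := pcov_gt0 Spd cZ; have cc'c' := pcov_gt0 Spd c'Z.
rewrite /sq_pcorr scr ler_pdivrMr ?mulr_gt0 //.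
(* After factoring out the squared regression coefficient of [a] on [c], Cauchy-Schwarz for [c] and
   [c'] remains. *)
have -> : pcov Sigma Z a c ^+ 2 / (pcov Sigma Z a a * pcov Sigma Z c c) *
      (pcov Sigma Z a a * pcov Sigma Z c' c') =
    (pcov Sigma Z a c / pcov Sigma Z c c) ^+ 2 * (pcov Sigma Z c c * pcov Sigma Z c' c').
  by field; rewrite !gt_eqF.
by rewrite exprMn ler_wpM2l ?sqr_ge0 // pcov_cauchy_schwarz.
Qed.
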